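(* Let $\mathcal{S}$ be a linear subdivision scheme with symbol $$a(z)=z^{-s}(1+z)\left(\prod_{i=1}^{m_1}\frac{1+\alpha_iz}{1+\alpha_i}\right)\left(\prod_{i=m_1+1}^{m_1+m_2}\frac{1+2\operatorname{Re}(\alpha_i)z+|\alpha_i|^2z^2}{1+2\operatorname{Re}(\alpha_i)+|\alpha_i|^2}\right),$$ where $s\in\mathbb{Z}$, $m_1,m_2\ge1$, $\alpha_i\in\mathbb{R}\setminus\{0,-1\}$ for $1\le i\le m_1$, $\alpha_i\in\mathbb{C}\setminus\mathbb{R}$ for $m_1<i\le m_1+m_2$, and $\max_{1\le i\le m_1}\alpha_i>0$. Define $$\mu_1=\min_{\substack{i\in\{1,\dots,m_1\}\\ \alpha_i>0}}\max\Big\{\frac{1}{1+\alpha_i},\frac{\alpha_i}{1+\alpha_i}\Big\},$$ and renumber the linear factors $\frac{1+\alpha_iz}{1+\alpha_i}$ such that $\mu_1$ is attained at $\alpha_1$. If $$\mu=\mu_1\prod_{i=2}^{m_1+m_2}\xi(\alpha_i)<1,$$ where $$\xi(\alpha_i)=\begin{cases}1,&0<\alpha_i,\\ 1+2\left|\frac{\alpha_i}{1+\alpha_i}\right|,&-1<\alpha_i<0,\\ 1+2\left|\frac{1}{1+\alpha_i}\right|,&\alpha_i<-1,\\ 1+2\left(\frac{2(|\alpha_i|-\operatorname{Re}(\alpha_i))}{1+2\operatorname{Re}(\alpha_i)+|\alpha_i|^2}\right),&\alpha_i\notin\mathbb{R},\end{cases}$$ then the adaptation $\widetilde{\mathcal{S}}$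 of $\mathcal{S}$ to manifold data based on the general global refinement step (described in the context) has contractivity factor $\mu$, and it converges from any initial admissible data on the manifold.
   Context: Linear scheme and symbol: a linear subdivision scheme has a refinement rule $\mathcal{S}(\mathbf{f})_j=\sum_{i\in\mathbb{Z}}a_{j-2i}f_i$ with finitely supported real mask $(a_i)_{i\in\mathbb{Z}}$; its symbol is $a(z)=\sum_{i}a_iz^i$. Geodesic averages: $\mathcal{M}$ is a complete connected Riemannian manifold with Riemannian distance $d$. For $p_1,p_2\in\mathcal{M}$, $t\mapsto M_t(p_1,p_2)$, $t\in[0,1]$, is the (canonically chosen, if not unique) shortest geodesic, parametrized with constant speed, with $M_0(p_1,p_2)=p_1$, $M_1(p_1,p_2)=p_2$. For the values $t\notin[0,1]$ that are used, $M_t(p_1,p_2)$ is assumed to be well-defined as a point on the continuation of this geodesic (same constant-speed parametrization), and $d(M_t(p_1,p_2),p_2)=|1-t|\,d(p_1,p_2)$, $d(p_1,M_t(p_1,p_2))=|t|\,d(p_1,p_2)$ for all $t$ used. A data sequence $\mathbf{p}=(p_i)_{i\in\mathbb{Z}}$ in $\mathcal{M}$ is admissible if the geodesic curve between any two adjacent points is well-defined; all geodesic averages occurring in the repeated refinement are assumed well-defined. Put $\delta(\mathbf{p})=\sup_{i\in\mathbb{Z}}d(p_i,p_{i+1})$; data are understood to satisfy $\delta(\mathbf{p})<\infty$. Three pyramid: for a non-real $\alpha$ put $D=1+2\operatorname{Re}(\alpha)+|\alpha|^2$, $w_1=\frac1D$, $w_2=\frac{2\operatorname{Re}(\alpha)}{D}$,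 $w_3=\frac{|\alpha|^2}{D}$. The three pyramid average of $p_1,p_2,p_3\in\mathcal{M}$ is $$\mathcal{P}\big((p_1,p_2,p_3),(w_1,w_2,w_3)\big)=M_r\big(M_{t_2}(p_3,p_2),M_{t_1}(p_2,p_1)\big)$$ with the parameters $r=\frac{1}{1+|\alpha|}$, $t_1=\frac{w_1}{r}=\frac{1+|\alpha|}{D}$, $t_2=1-\frac{w_3}{1-r}=\frac{1+2\operatorname{Re}(\alpha)-|\alpha|}{D}$. General global refinement step $\mathbf{p}\mapsto\widetilde{\mathcal{S}}(\mathbf{p})$: set $q_{2i,0}=q_{2i+1,0}=p_i$ for $i\in\mathbb{Z}$; for $j=1,\dots,m_1$ successively set $q_{i,j}=M_{\frac{\alpha_j}{1+\alpha_j}}(q_{i,j-1},q_{i+1,j-1})$ for all $i$; for $j=m_1+1,\dots,m_1+m_2$ successively set $q_{i,j}=\mathcal{P}\big((q_{i,j-1},q_{i+1,j-1},q_{i+2,j-1}),(w_1,w_2,w_3)\big)$ for all $i$, with weights and parameters determined by $\alpha=\alpha_j$; finally set $\widetilde{\mathcal{S}}(\mathbf{p})_{i-s+1}=q_{i,m_1+m_2}$ for all $i$. The subdivision scheme is the repeated application of this step. Contractivity factor: $\widetilde{\mathcal{S}}$ has contractivity factor $\mu\in(0,1)$ if $\delta(\widetilde{\mathcal{S}}(\mathbf{p}))\le\mu\,\delta(\mathbf{p})$ for all data $\mathbf{p}$. Convergence: for $k\ge 0$ let $I(\widetilde{\mathcal{S}}^k(\mathbf{p})):\mathbb{R}\to\mathcal{M}$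 be the piecewise geodesic interpolant that takes the value $\widetilde{\mathcal{S}}^k(\mathbf{p})_i$ at $i2^{-k}$ and, on $[i2^{-k},(i+1)2^{-k}]$, follows (with constant speed) the geodesic curve connecting $\widetilde{\mathcal{S}}^k(\mathbf{p})_i$ and $\widetilde{\mathcal{S}}^k(\mathbf{p})_{i+1}$. The scheme converges from $\mathbf{p}$ if the sequence $I(\widetilde{\mathcal{S}}^k(\mathbf{p}))$, $k\in\mathbb{Z}_+$, converges uniformly with respect to $d$. *)

(* Defs.v *)
From HB Require Import structures.
From mathcomp Require Import all_boot all_order all_algebra.
From mathcomp Require Import all_classical all_reals all_analysis.
From mathcomp Require Import complex.

Set Implicit Arguments.
Unset Strict Implicit.
Unset Printing Implicit Defensive.

Import Order.TTheory GRing.Theory Num.Theory.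
Import numFieldNormedType.Exports.

Local Open Scope classical_set_scope.
Local Open Scope ring_scope.
Local Open Scope complex_scope.

(* The sets U below are open, so the derivatives of f at points of U only
   depend on f restricted to U. *)
Fixpoint Ck_on (R : realType) (V W : normedModType R) (k : nat)
    (U : set V) (f : V -> W) : Prop :=
  if k is k'.+1 then
    (forall u, U u -> differentiable f u) /\
    (forall v : V, Ck_on k' U (fun u => 'D_v f u))
  else forall u, U u -> {for u, continuous f}.

Definition smooth_on (R : realType) (V W : normedModType R)
    (U : set V) (f : V -> W) : Prop := forall k, Ck_on k U f.

(* A smooth n-dimensional manifold with a Riemannian metric, on a carrier whose
   topology is given by the distance of the metricType M.  This distance is
   related to the Riemannian metric by is_riemannian_distance below; the
   Hausdorff property and paracompactness come with the metric topology.
   gram i u is the Gram matrix of the Riemannian metric at the point with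
   coordinates u in the chart i; the values of chart i outside chart_dom i, and
   those of chart_inv i and gram i outside the image of the chart, are junk. *)
Record riemannian_structure (R : realType) (n : nat) (M : metricType R) := {
  chart_index : Type ;
  chart_dom : chart_index -> set M ;
  chart : chart_index -> M -> 'rV[R]_n ;
  chart_inv : chart_index -> 'rV[R]_n -> M ;
  chart_at : M -> chart_index ;
  gram : chart_index -> 'rV[R]_n -> 'M[R]_n ;
  chart_img := fun i => chart i @` chart_dom i ;
  transition := fun i j => chart j \o chart_inv i ;
  mem_chart_at : forall x, chart_dom (chart_at x) x ;
  chart_dom_open : forall i, open (chart_dom i) ;
  chart_img_open : forall i, open (chart_img i) ;
  chartK : forall i x, chart_dom i x -> chart_inv i (chart i x) = x ;
  chart_continuous : forall i x, chart_dom i x -> {for x, continuous (chart i)} ;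
  chart_inv_continuous : forall i u, chart_img i u ->
    {for u, continuous (chart_inv i)} ;
  transition_smooth : forall i j,
    smooth_on (chart i @` (chart_dom i `&` chart_dom j)) (transition i j) ;
  gram_smooth : forall i k l,
    smooth_on (chart_img i) (fun u => gram i u k l : R^o) ;
  gram_sym : forall i u, chart_img i u -> (gram i u)^T = gram i u ;
  gram_posdef : forall i u (v : 'rV[R]_n), chart_img i u -> v != 0 ->
    0 < (v *m gram i u *m v^T) 0 0 ;
  gram_transition : forall i j u (v w : 'rV[R]_n),
    (chart i @` (chart_dom i `&` chart_dom j)) u ->
    (v *m gram i u *m w^T) 0 0 =
    ('D_v (transition i j) u *m gram j (transition i j u)
       *m ('D_w (transition i j) u)^T) 0 0
}.

Section Curves.
Context (R : realType) (n : nat) (M : metricType R).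
Variable X : riemannian_structure n M.

(* Riemannian norm of the velocity, computed in the chart chosen at g t; by
   gram_transition any other chart around g t gives the same value. *)
Definition speed (g : R -> M) (t : R) : R :=
  let i := chart_at X (g t) in
  let v := derive1 (chart i \o g) t in
  Num.sqrt ((v *m gram i (chart i (g t)) *m v^T) 0 0).

Definition curve_length (g : R -> M) (a b : R) : R :=
  (\int[lebesgue_measure]_(t in `[a, b]) speed g t)%R.

(* Curves are total functions on R; being C^1 on [a, b] means being C^1 in a
   neighbourhood of each of its points (a curve which is C^1 on [a, b] with
   one-sided derivatives at a and b has such an extension). *)
Definition C1_on (g : R -> M) (a b : R) : Prop :=
  forall t, a <= t <= b ->
    {for t, continuous g} /\
    forall i : chart_index X, chart_dom i (g t) ->
      (\forall s \near t, derivable (chart i \o g) s 1) /\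
      {for t, continuous (derive1 (chart i \o g))}.

(* pw_curve x y L: some piecewise C^1 curve from x to y has length L. *)
Inductive pw_curve : M -> M -> R -> Prop :=
| pw_piece (g : R -> M) (a b : R) : a <= b -> C1_on g a b ->
    pw_curve (g a) (g b) (curve_length g a b)
| pw_cat (x y z : M) (L1 L2 : R) : pw_curve x y L1 -> pw_curve y z L2 ->
    pw_curve x z (L1 + L2).

Definition is_riemannian_distance : Prop :=
  forall x y : M, mdist x y = inf [set L | pw_curve x y L].

(* d/du_a of the (b, l) entry of the Gram matrix *)
Definition dgram (i : chart_index X) (a b l : 'I_n) (u : 'rV[R]_n) : R :=
  'D_(delta_mx 0 a : 'rV[R]_n) (fun w : 'rV[R]_n => gram i w b l : R^o) u.

Definition christoffel (i : chart_index X) (k a b : 'I_n) (u : 'rV[R]_n) : R :=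
  2^-1 * \sum_(l < n) invmx (gram i u) k l *
    (dgram i a b l u + dgram i b a l u - dgram i l a b u).

Definition is_geodesic (g : R -> M) : Prop :=
  forall t, {for t, continuous g} /\
    forall i : chart_index X, chart_dom i (g t) ->
      let x := chart i \o g in
      let x' := derive1 x in
      [/\ derivable x t 1, derivable x' t 1 &
        forall k, derive1 x' t 0 k +
          \sum_(a < n) \sum_(b < n)
            christoffel i k a b (x t) * x' t 0 a * x' t 0 b = 0].

Definition shortest_geodesic (p q : M) (g : R -> M) : Prop :=
  [/\ is_geodesic g, exists c, forall t, speed g t = c, g 0 = p, g 1 = q
    & curve_length g 0 1 = mdist p q].

(* The canonical choice of shortest geodesics: geod_def p q says that a
   geodesic is chosen for p, q, and then t |-> geod p q t, t in R, is this
   geodesic for t in [0, 1] together with its continuation, which exists for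
   all t on a complete manifold. *)
Record geodesic_choice := {
  geod_def : M -> M -> Prop ;
  geod : M -> M -> R -> M ;
  geodP : forall p q, geod_def p q -> shortest_geodesic p q (geod p q)
}.

End Curves.

Definition complete_space (R : realType) (M : metricType R) : Prop :=
  forall F : set_system M, ProperFilter F -> cauchy F -> exists x : M, F --> x.

Section Refinement.
Context (R : realType) (n : nat) (M : metricType R).
Variables (X : riemannian_structure n M) (G : geodesic_choice X).

Definition avg (t : R) (p q : M) : M := geod G p q t.

Definition avg_def (t : R) (p q : M) : Prop :=
  [/\ geod_def G p q,
      mdist (avg t p q) q = `|1 - t| * mdist p q
    & mdist p (avg t p q) = `|t| * mdist p q].

Definition modulus (z : R[i]) : R := Normc.normc z.
Definition pyr_D (z : R[i]) : R := 1 + 2 * complex.Re z + modulus z ^+ 2.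
Definition pyr_w1 (z : R[i]) : R := 1 / pyr_D z.
Definition pyr_w3 (z : R[i]) : R := modulus z ^+ 2 / pyr_D z.
Definition pyr_r (z : R[i]) : R := 1 / (1 + modulus z).
Definition pyr_t1 (z : R[i]) : R := pyr_w1 z / pyr_r z.
Definition pyr_t2 (z : R[i]) : R := 1 - pyr_w3 z / (1 - pyr_r z).

Definition pyramid (z : R[i]) (p1 p2 p3 : M) : M :=
  avg (pyr_r z) (avg (pyr_t2 z) p3 p2) (avg (pyr_t1 z) p2 p1).

Definition pyramid_def (z : R[i]) (p1 p2 p3 : M) : Prop :=
  [/\ avg_def (pyr_t2 z) p3 p2, avg_def (pyr_t1 z) p2 p1 &
    avg_def (pyr_r z) (avg (pyr_t2 z) p3 p2) (avg (pyr_t1 z) p2 p1)].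

Variables (s : int) (m1 m2 : nat).
(* nth entries, counted from 0: alpha_(j+1) = al`_j for j < m1 and
   alpha_(m1+j+1) = be`_j for j < m2 *)
Variables (al : m1.-tuple R) (be : m2.-tuple R[i]).

(* stage p j i is q_{i,j} *)
Fixpoint stage (p : int -> M) (j : nat) : int -> M :=
  if j is j'.+1 then
    let q := stage p j' in
    if (j' < m1)%N then
      fun i => avg (al`_j' / (1 + al`_j')) (q i) (q (i + 1))
    else
      fun i => pyramid (be`_(j' - m1)%N) (q i) (q (i + 1)) (q (i + 2))
  else fun i => p (i %/ 2)%Z.

Definition refine (p : int -> M) : int -> M :=
  fun k => stage p (m1 + m2) (k + s - 1).

Definition step_def (p : int -> M) : Prop :=
  forall (j : nat) (i : int), (j < m1 + m2)%N ->
    let q := stage p j in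
    if (j < m1)%N then
      avg_def (al`_j / (1 + al`_j)) (q i) (q (i + 1))
    else
      pyramid_def (be`_(j - m1)%N) (q i) (q (i + 1)) (q (i + 2)).

Definition admissible (p : int -> M) : Prop :=
  forall i, geod_def G (p i) (p (i + 1)).

Definition delta (p : int -> M) : \bar R :=
  ereal_sup (range (fun i : int => (mdist (p i) (p (i + 1)))%:E)).

Definition has_contractivity_factor (mu : R) : Prop :=
  0 < mu < 1 /\
  forall p : int -> M, admissible p -> (delta p < +oo)%E -> step_def p ->
    (delta (refine p) <= mu%:E * delta p)%E.

(* all geodesics and averages occurring in the repeated refinement of p *)
Definition refinement_def (p : int -> M) : Prop :=
  forall k : nat, admissible (iter k refine p) /\ step_def (iter k refine p).

Definition interpolant (k : nat) (p : int -> M) : R -> M :=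
  fun x => let y := x * 2 ^+ k in
    let i := Num.floor y in
    geod G (p i) (p (i + 1)) (y - i%:~R).

Definition converges_from (p : int -> M) : Prop :=
  exists F : R -> M,
    {uniform, (fun k => interpolant k (iter k refine p)) @ \oo --> F}.

End Refinement.

Section Linear.
Context (R : realType).

Definition linear_scheme (a f : int -> R) : int -> R :=
  fun j => \sum_(i \in [set: int]) a (j - 2 * i) * f i.

Definition symbol (a : int -> R) (z : R[i]) : R[i] :=
  \sum_(i \in [set: int]) (a i)%:C * z ^ i.

Definition factored_symbol (s : int) (m1 m2 : nat) (al : m1.-tuple R)
    (be : m2.-tuple R[i]) (z : R[i]) : R[i] :=
  z ^ (- s) * (1 + z)
  * (\prod_(a <- al) ((1 + a%:C * z) / (1 + a%:C)))
  * (\prod_(b <- be) ((1 + (2 * complex.Re b)%:C * z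
                         + (modulus b ^+ 2)%:C * z ^+ 2) / (pyr_D b)%:C)).

Definition lin_factor (a : R) : R := Num.max (1 / (1 + a)) (a / (1 + a)).

(* The neutral element 1 plays no role as soon as some entry of al is positive:
   lin_factor a < 1 for a > 0. *)
Definition mu1 (m1 : nat) (al : m1.-tuple R) : R :=
  \big[Num.min/1]_(a <- al | 0 < a) lin_factor a.

Definition xi (z : R[i]) : R :=
  let x := complex.Re z in
  if complex.Im z != 0 then 1 + 2 * (2 * (modulus z - x) / pyr_D z)
  else if 0 < x then 1
  else if -1 < x then 1 + 2 * `|x / (1 + x)|
  else 1 + 2 * `|1 / (1 + x)|.

(* the product of the xi(alpha_i) leaves out the first linear factor *)
Definition mu (m1 m2 : nat) (al : m1.-tuple R) (be : m2.-tuple R[i]) : R :=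
  mu1 al * (\prod_(a <- behead al) xi a%:C * \prod_(b <- be) xi b).

End Linear.

(* Main.v *)
Require Import Defs.
From mathcomp Require Import all_boot all_order all_algebra.
From mathcomp Require Import all_classical all_reals all_analysis.
From mathcomp Require Import complex.
From mathcomp Require Import ring lra zify.

Set Implicit Arguments.
Unset Strict Implicit.
Unset Printing Implicit Defensive.

Import Order.TTheory GRing.Theory Num.Theory.
Import numFieldNormedType.Exports.

Local Open Scope classical_set_scope.
Local Open Scope ring_scope.
Local Open Scope complex_scope.

(** Every averaging round multiplies the largest distance d of consecutive
    points by at most its factor.  The first round acts on doubled points, so it
    cuts each edge in the ratio t : 1 - t, which yields max(t, 1 - t).  A later
    geodesic average yields |1 - t| + |t|, by the triangle inequality through
    the point shared by the two edges.  Two consecutive pyramids P = M_r(A, B)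
    and P' = M_r(A', B'), where A and B' are the averages of (p_3, p_2) with
    parameters t_2 and t_1, are compared along the path P, A, B', P'.  With
    e = 2 (|alpha| - Re alpha) / D both d(A, B) and d(A', B') are at most
    (1 + e) d, so the outer legs contribute r (1 + e) d and (1 - r) (1 + e) d;
    the middle leg stays on one constant-speed geodesic, so it has length at
    most |t_1 - t_2| d = e d.  A refinement step displaces points by at most a
    fixed multiple of d, so successive interpolants differ by O(mu^k),
    uniformly. *)

(** * Distances along a constant-speed geodesic *)

Section Geodesics.
Context (R : realType) (n : nat) (M : metricType R).
Variable X : riemannian_structure n M.
Hypothesis hdist : is_riemannian_distance X.

Lemma pw_curve_ge0 (x y : M) (L : R) : pw_curve X x y L -> 0 <= L.
Proof.
elim=> [g a b _ _|x1 y1 z1 L1 L2 _ L1_ge0 _ L2_ge0]; last exact: addr_ge0.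
by apply: Rintegral_ge0 => t _; exact: sqrtr_ge0.
Qed.

Lemma mdist_le_curve_length (g : R -> M) (a b : R) :
  a <= b -> C1_on X g a b -> mdist (g a) (g b) <= curve_length X g a b.
Proof.
move=> ab g1; rewrite hdist; apply: ge_inf; last exact: pw_piece.
by exists 0 => L; exact: pw_curve_ge0.
Qed.

(** Openness of [chart_dom i] keeps nearby points in the chart, and the second derivative in the
    geodesic equation makes the velocity continuous. *)
Lemma geodesic_C1 (g : R -> M) (a b : R) : is_geodesic X g -> C1_on X g a b.
Proof.
move=> gg t _; have [gt gti] := gg t; split=> // i git; split.
  have : \forall s \near t, chart_dom i (g s).
    by apply: gt; exact: open_nbhs_nbhs (conj (chart_dom_open i) git).
  by apply: filterS => s gis; have [_ /(_ i gis)[]] := gg s.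
have [_ dx' _] := gti i git.
exact/differentiable_continuous/derivable1_diffP.
Qed.

Lemma curve_length_cst (g : R -> M) (c a b : R) :
  a <= b -> (forall t, speed X g t = c) -> curve_length X g a b = c * (b - a).
Proof.
move=> ab gc; rewrite /curve_length; under eq_Rintegral do rewrite gc.
rewrite Rintegral_cst//= lebesgue_measure_itv/= lte_fin.
by case: ltgtP ab => [||->]//=; rewrite subrr.
Qed.

(** The constant speed equals the length over [0, 1], which is [mdist p q]; the arc between [a] and
    [b] has speed times |b - a| as length and bounds the distance. The parameters may lie outside
    [0, 1]. *)
Lemma shortest_geodesic_mdist (p q : M) (g : R -> M) (a b : R) :
  shortest_geodesic X p q g -> mdist (g a) (g b) <= `|b - a| * mdist p q.
Proof.
move=> [gg [c gc] _ _ glen].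
have cE : c = mdist p q.
  by rewrite -glen (curve_length_cst ler01 gc) subr0 mulr1.
wlog ab : a b / a <= b => [hw|].
  have [|/ltW ba] := leP a b; first exact: hw.
  by rewrite metric_sym distrC; exact: hw.
rewrite ger0_norm ?subr_ge0// mulrC -cE -(curve_length_cst ab gc).
exact/mdist_le_curve_length/geodesic_C1.
Qed.

End Geodesics.

(** * Uniform convergence from geometrically decaying steps *)

Section UniformLimit.
Context (R : realType) (M : metricType R).
Hypothesis hcompl : complete_space M.
Context (T : choiceType) (u : nat -> T -> M) (K q : R).
Hypotheses (K_ge0 : 0 <= K) (q_ge0 : 0 <= q) (q_lt1 : q < 1).
Hypothesis step_u : forall k x, mdist (u k x) (u k.+1 x) <= K * q ^+ k.

Let C := K / (1 - q).

Lemma geometric_step_mdist k m x : mdist (u k x) (u (k + m) x) <= C * q ^+ k.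
Proof.
have q1 : 1 - q != 0 by rewrite subr_eq0 eq_sym lt_eqF.
have C_ge0 : 0 <= C by rewrite divr_ge0// subr_ge0 ltW.
(* This telescoping form survives induction on [m], since [C * (1 - q) = K]. *)
suff h : mdist (u k x) (u (k + m) x) <= C * (q ^+ k - q ^+ (k + m)).
  by apply: (le_trans h); rewrite ler_wpM2l// lerBlDr lerDl exprn_ge0.
elim: m => [|m IH]; first by rewrite addn0 mdistxx subrr mulr0.
rewrite addnS; apply: le_trans (metric_triangle _ (u (k + m) x) _) _.
apply: le_trans (lerD IH (step_u _ _)) _; rewrite exprS /C le_eqVlt; apply/orP.
by left; apply/eqP; field.
Qed.

Lemma geometric_bound_small e : 0 < e -> \forall k \near \oo, C * q ^+ k < e.
Proof.
move=> e0; have : (C * q ^+ k @[k --> \oo] --> C * 0)%classic.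
  by apply: cvgMr; apply: cvg_expr; rewrite ger0_norm.
rewrite mulr0 => /cvgrPdist_lt/(_ _ e0); apply: filterS => k.
rewrite /mdist/= sub0r normrN; apply: le_lt_trans; exact: ler_norm.
Qed.

(** Completeness gives pointwise limits; the tail bound [C * q ^+ k] passes to the limit and is
    independent of [x]. *)
Lemma geometric_steps_cvg_uniform : exists F : T -> M, {uniform, u @ \oo --> F}.
Proof.
have lim_u x : exists y : M, (fun k => u k x) @ \oo --> y.
  apply: hcompl; apply/cauchy_exP => e e0.
  have [N _ hN] := geometric_bound_small e0.
  exists (u N x); exists N => // k /= Nk; rewrite ballEmdist/= -(subnKC Nk).
  by apply: le_lt_trans (geometric_step_mdist _ _ _) _; exact: hN (leqnn N).
have [F uF] := choice lim_u.
have uFC k x : mdist (F x) (u k x) <= C * q ^+ k.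
  apply/ler_addgt0Pl => e e0.
  have [N _ hN] := uF x _ (nbhsx_ballx (F x) e e0).
  have {}hN : mdist (F x) (u (k + N) x) < e.
    by have := hN (k + N) (leq_addl _ _); rewrite /= ballEmdist.
  apply: le_trans (metric_triangle _ (u (k + N) x) _) _.
  by rewrite lerD ?(ltW hN)// metric_sym geometric_step_mdist.
exists F => P /uniform_nbhs[E []]; rewrite -entourage_ballE => -[e e0 eE] EP.
have [N _ hN] := geometric_bound_small e0.
exists N => // k /= Nk; apply: EP => x _; apply: eE; rewrite /= ballEmdist/=.
exact: le_lt_trans (uFC k x) (hN k Nk).
Qed.

End UniformLimit.

(** Relates the dyadic cells of one parameter at successive levels: the index at the finer level
    halves to the index at the coarser one. *)
Lemma floor_half (R : realType) (y : R) :
  (Num.floor (y * 2) %/ 2)%Z = Num.floor y.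
Proof.
set j := Num.floor _; apply/esym/floor_def.
have : j%:~R <= y * 2 < (j + 1)%:~R by rewrite floor_itv.
have : (2 * (j %/ 2)%Z)%:~R <= j%:~R :> R by rewrite ler_int; lia.
have : (j + 1)%:~R <= (2 * ((j %/ 2)%Z + 1))%:~R :> R by rewrite ler_int; lia.
by rewrite !intrM; lra.
Qed.

(** * The factors of the averaging rounds and the pyramid parameters *)

Section Factors.
Context (R : realType).

(** The two weights sum to 1. Both are positive for x > 0; otherwise exactly one is negative, which
    adds twice its absolute value. *)
Lemma xi_real (x : R) : x != 0 -> x != -1 ->
  xi x%:C = `|1 - x / (1 + x)| + `|x / (1 + x)|.
Proof.
move=> x0 xN1; have x1 : 1 + x != 0 by rewrite addrC addr_eq0.
have -> : 1 - x / (1 + x) = 1 / (1 + x) by field.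
rewrite /xi /= eqxx /=; case: ifPn => [x_gt0|x_le0].
  by rewrite !ger0_norm ?divr_ge0 ?addr_ge0 ?ltW// ?ler01//; field.
have x_lt0 : x < 0 by rewrite lt_neqAle x0 leNgt.
have xE : 1 / (1 + x) = 1 - x / (1 + x) by field.
case: ifPn => [x_gtN1|x_leN1].
  have x1_gt0 : 0 < 1 + x by lra.
  have h : x / (1 + x) <= 0 by rewrite ltW// nmulr_rlt0 ?invr_gt0.
  by rewrite (ler0_norm h) ger0_norm ?divr_ge0 ?ltW// xE; ring.
have x1_lt0 : 1 + x < 0.
  by rewrite lt_neqAle x1/=; move: x_leN1; rewrite -leNgt; lra.
have h : 1 / (1 + x) < 0 by rewrite pmulr_rlt0 ?invr_lt0.
rewrite (ltr0_norm h) ger0_norm; last by move: h; rewrite xE; lra.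
by rewrite xE; ring.
Qed.

Lemma modulus_ge0 (z : R[i]) : 0 <= modulus z.
Proof. by case: z => x y; exact: sqrtr_ge0. Qed.

Lemma modulus_sqr (z : R[i]) :
  modulus z ^+ 2 = complex.Re z ^+ 2 + complex.Im z ^+ 2.
Proof. by case: z => x y; rewrite sqr_sqrtr ?addr_ge0 ?sqr_ge0. Qed.

Lemma Re_le_modulus (z : R[i]) : complex.Re z <= modulus z.
Proof.
apply: le_trans (ler_norm _) _.
rewrite -(ler_pXn2r (_ : 0 < 2)%N) ?nnegrE ?modulus_ge0//.
by rewrite modulus_sqr -normrX ger0_norm ?sqr_ge0// lerDl sqr_ge0.
Qed.

(** [pyr_D z] is |1 + z|^2 = (1 + Re z)^2 + (Im z)^2. *)
Lemma pyr_D_gt0 (z : R[i]) : complex.Im z != 0 -> 0 < pyr_D z.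
Proof.
move=> z_im; rewrite /pyr_D modulus_sqr.
have : 0 < complex.Im z ^+ 2 by rewrite exprn_even_gt0.
have := sqr_ge0 (1 + complex.Re z); nra.
Qed.

Lemma modulus_gt0 (z : R[i]) : complex.Im z != 0 -> 0 < modulus z.
Proof.
move=> z_im; rewrite lt_neqAle modulus_ge0 andbT eq_sym -sqrf_eq0 modulus_sqr.
by rewrite gt_eqF// ltr_wpDl ?sqr_ge0// exprn_even_gt0.
Qed.

Lemma subr_pyr_r (z : R[i]) : 1 - pyr_r z = modulus z / (1 + modulus z).
Proof.
have m_ge0 := modulus_ge0 z.
have m1 : 1 + modulus z != 0 by rewrite gt_eqF ?ltr_pwDl.
by rewrite /pyr_r; field.
Qed.

Lemma pyr_t1E (z : R[i]) : pyr_t1 z = (1 + modulus z) / pyr_D z.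
Proof. by rewrite /pyr_t1 /pyr_w1 /pyr_r !div1r invrK mulrC. Qed.

Lemma pyr_t2E (z : R[i]) : complex.Im z != 0 ->
  pyr_t2 z = 1 - modulus z * (1 + modulus z) / pyr_D z.
Proof.
move=> z_im; have m_gt0 := modulus_gt0 z_im.
have m0 : modulus z != 0 by rewrite gt_eqF.
have m1 : 1 + modulus z != 0 by rewrite gt_eqF ?addr_gt0.
have D0 : pyr_D z != 0 by rewrite gt_eqF ?pyr_D_gt0.
by rewrite /pyr_t2 subr_pyr_r /pyr_w3; field; rewrite D0 m1 m0.
Qed.

Lemma xi_ge1 (z : R[i]) : 1 <= xi z.
Proof.
rewrite /xi; case: ifPn => [z_im|_].
  rewrite lerDl !mulr_ge0 ?invr_ge0 ?subr_ge0 ?Re_le_modulus//.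
  by rewrite ltW// pyr_D_gt0.
by case: ifPn => // _; case: ifPn => _; rewrite lerDl mulr_ge0.
Qed.

Lemma mu1_perm (m1 : nat) (al al0 : m1.-tuple R) :
  perm_eq al0 al -> mu1 al0 = mu1 al.
Proof. exact: perm_big. Qed.

Lemma lin_factor_gt0 (x : R) : 0 < x -> 0 < lin_factor x.
Proof. by move=> x0; rewrite lt_max divr_gt0 ?addr_gt0. Qed.

End Factors.

(** * Real bounds on consecutive distances *)

Section StepBounds.
Context (R : realType) (M : metricType R).

Definition step_le (d : R) (p : int -> M) : Prop :=
  forall i, mdist (p i) (p (i + 1)) <= d.

Lemma step_le_mdist (d : R) (p : int -> M) (i j : int) : step_le d p ->
  mdist (p i) (p j) <= `|j - i|%:~R * d.
Proof.
move=> pd; wlog ij : i j / i <= j => [hw|].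
  have [|/ltW ji] := leP i j; first exact: hw.
  by rewrite metric_sym distrC; exact: hw.
have -> : j = i + `|j - i|%N by lia.
have -> : `|i + `|(j - i)%R|%N - i| = `|(j - i)%R|%N :> int by lia.
elim: `|_|%N => [|k IH]; first by rewrite addr0 mdistxx mul0r.
apply: le_trans (metric_triangle _ (p (i + k)) _) _.
rewrite -addn1 PoszD intrD mulrDl mul1r lerD// addrA; exact: pd.
Qed.

Lemma delta_step_le (p : int -> M) : (delta p < +oo)%E ->
  exists2 d : R, delta p = d%:E & step_le d p.
Proof.
have pd i : ((mdist (p i) (p (i + 1)))%:E <= delta p)%E.
  by apply: ereal_sup_ubound; exists i.
move=> dp; have dp_ge0 : (0 <= delta p)%E.
  by apply: le_trans (pd 0); rewrite lee_fin mdist_ge0.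
exists (fine (delta p)) => [|i]; first by rewrite fineK// ge0_fin_numE.
by rewrite -lee_fin fineK// ge0_fin_numE.
Qed.

Lemma step_le_delta (d : R) (p : int -> M) : step_le d p -> (delta p <= d%:E)%E.
Proof. by move=> pd; apply: ge_ereal_sup => _ [i _ <-]; rewrite lee_fin. Qed.

End StepBounds.

(** * Effect of a single averaging round *)

Section Steps.
Context (R : realType) (n : nat) (M : metricType R).
Variable X : riemannian_structure n M.
Hypothesis hdist : is_riemannian_distance X.
Variable G : geodesic_choice X.

Lemma mdist_avg (p q : M) (s t : R) : geod_def G p q ->
  mdist (avg G s p q) (avg G t p q) <= `|t - s| * mdist p q.
Proof. by move=> /geodP; exact: shortest_geodesic_mdist. Qed.

Lemma avg_step (t d : R) (p q r : M) :
  avg_def G t p q -> avg_def G t q r -> mdist p q <= d -> mdist q r <= d ->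
  mdist (avg G t p q) (avg G t q r) <= (`|1 - t| + `|t|) * d.
Proof.
move=> [_ tpq _] [_ _ tqr] pq qr.
apply: le_trans (metric_triangle _ q _) _.
by rewrite tpq tqr mulrDl lerD// ler_wpM2l.
Qed.

(** The path through [p2] has legs with factors 1 - t_2 = |z|(1 + |z|)/D and t_1 = (1 + |z|)/D. *)
Lemma pyramid_inner (z : R[i]) (d : R) (p1 p2 p3 : M) : complex.Im z != 0 ->
  pyramid_def G z p1 p2 p3 -> mdist p1 p2 <= d -> mdist p2 p3 <= d ->
  mdist (avg G (pyr_t2 z) p3 p2) (avg G (pyr_t1 z) p2 p1) <=
    (1 + modulus z) ^+ 2 / pyr_D z * d.
Proof.
move=> z_im [[_ d32 _] [_ _ d21] _] d12 d23.
have m_ge0 := modulus_ge0 z; have m1_ge0 := addr_ge0 ler01 m_ge0.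
have D_ge0 := ltW (pyr_D_gt0 z_im).
apply: le_trans (metric_triangle _ p2 _) _; rewrite d32 d21.
have -> : (1 + modulus z) ^+ 2 / pyr_D z = `|1 - pyr_t2 z| + `|pyr_t1 z|.
  rewrite pyr_t2E// pyr_t1E// subKr !ger0_norm ?divr_ge0 ?mulr_ge0//.
  by rewrite -mulrDl; congr (_ / _); ring.
by rewrite mulrDl lerD// ler_wpM2l// metric_sym.
Qed.

Lemma pyramid_step (z : R[i]) (d : R) (p1 p2 p3 p4 : M) : complex.Im z != 0 ->
  pyramid_def G z p1 p2 p3 -> pyramid_def G z p2 p3 p4 ->
  mdist p1 p2 <= d -> mdist p2 p3 <= d -> mdist p3 p4 <= d ->
  mdist (pyramid G z p1 p2 p3) (pyramid G z p2 p3 p4) <= xi z * d.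
Proof.
move=> z_im P123 P234 d12 d23 d34.
have := pyramid_inner z_im P123 d12 d23.
have := pyramid_inner z_im P234 d23 d34.
have [[g32 _ _] _ [_ _ dP]] := P123; have [_ _ [_ dP' _]] := P234.
set A := avg G (pyr_t2 z) p3 p2; set B := avg G (pyr_t1 z) p2 p1.
set A' := avg G (pyr_t2 z) p4 p3; set B' := avg G (pyr_t1 z) p3 p2.
set c := _ / _ * d => hA'B' hAB.
have m_ge0 := modulus_ge0 z; have m1_ge0 := addr_ge0 ler01 m_ge0.
have D_gt0 := pyr_D_gt0 z_im; have D_ge0 := ltW D_gt0.
have r_ge0 : 0 <= pyr_r z by rewrite divr_ge0.
have r_le1 : 0 <= 1 - pyr_r z by rewrite subr_pyr_r divr_ge0.
set e := 2 * (modulus z - complex.Re z) / pyr_D z.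
(* Here (1 + |z|)^2 - D = 2(|z| - Re z). *)
have cE : (1 + modulus z) ^+ 2 / pyr_D z = 1 + e.
  by rewrite /e; move: D_gt0; rewrite /pyr_D => /gt_eqF/negbT D0; field.
have e_ge0 : 0 <= e by rewrite !mulr_ge0 ?invr_ge0 ?subr_ge0 ?Re_le_modulus.
(* [A] and [B'] lie on the same geodesic from [p3] to [p2], at parameters t_2 and t_1. *)
have AB' : mdist A B' <= e * d.
  apply: le_trans (mdist_avg _ _ g32) _.
  have -> : pyr_t1 z - pyr_t2 z = e.
    apply: (addrI 1); rewrite -cE pyr_t1E pyr_t2E//.
    by move: D_gt0 => /gt_eqF/negbT D0; field.
  by rewrite ger0_norm// ler_wpM2l// metric_sym.
apply: le_trans (metric_triangle _ A _) _.
rewrite metric_sym dP (ger0_norm r_ge0).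
apply: le_trans (lerD (ler_wpM2l r_ge0 hAB) (metric_triangle _ B' _)) _.
rewrite (metric_sym B') dP' (ger0_norm r_le1).
apply: le_trans (lerD (lexx _) (lerD AB' (ler_wpM2l r_le1 hA'B'))) _.
(* The outer legs have weights r and 1 - r, so the total is (1 + e) + e. *)
have -> : xi z = 1 + 2 * e by rewrite /xi z_im /e; ring.
by rewrite /c cE le_eqVlt; apply/orP; left; apply/eqP; ring.
Qed.

Lemma avg_shift (t d : R) (p q : M) : avg_def G t p q -> mdist p q <= d ->
  mdist (avg G t p q) p <= `|t| * d.
Proof. by move=> [_ _ tpq] pq; rewrite metric_sym tpq ler_wpM2l. Qed.

(** The path runs through the average of [p2] and [p1]. This displacement bound serves the
    comparison of successive interpolants. *)
Lemma pyramid_shift (z : R[i]) (d : R) (p1 p2 p3 : M) : complex.Im z != 0 ->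
  pyramid_def G z p1 p2 p3 -> mdist p1 p2 <= d -> mdist p2 p3 <= d ->
  mdist (pyramid G z p1 p2 p3) p1 <=
    (`|1 - pyr_r z| * ((1 + modulus z) ^+ 2 / pyr_D z) + `|1 - pyr_t1 z|) * d.
Proof.
move=> z_im P123 d12 d23; have AB := pyramid_inner z_im P123 d12 d23.
have [_ [_ dB _] [_ dP _]] := P123.
apply: le_trans (metric_triangle _ (avg G (pyr_t1 z) p2 p1) _) _.
by rewrite dP dB mulrDl -mulrA lerD// ler_wpM2l// metric_sym.
Qed.

End Steps.

(** * The full refinement step, contractivity and convergence *)

Section Scheme.
Context (R : realType) (n : nat) (M : metricType R).
Variable X : riemannian_structure n M.
Hypothesis hdist : is_riemannian_distance X.
Variable G : geodesic_choice X.
Variables (s : int) (m1 m2 : nat).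
Variables (al : m1.-tuple R) (be : m2.-tuple R[i]).
Hypothesis m1_gt0 : (0 < m1)%N.
Hypothesis al_neq : forall x, x \in al -> x != 0 /\ x != -1.
Hypothesis be_im : forall z, z \in be -> complex.Im z != 0.
Hypothesis al0_gt0 : 0 < al`_0.

(** Entry [j], counted from 0, is the factor of the round leading from stage [j] to stage [j.+1];
    products over [take j factors] bound stage [j]. *)
Definition factors : seq R :=
  lin_factor al`_0 :: [seq xi x%:C | x <- behead al] ++ [seq xi z | z <- be].

Lemma size_factors : size factors = (m1 + m2)%N.
Proof.
by rewrite /= size_cat !size_map size_behead !size_tuple -addSn prednK.
Qed.

Lemma nth_factors_lin (j : nat) : (j.+1 < m1)%N ->
  nth 0 factors j.+1 = xi (al`_j.+1)%:C.
Proof.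
move=> jm; have jb : (j < size (behead al))%N.
  by rewrite size_behead size_tuple; lia.
by rewrite /= nth_cat size_map jb (nth_map 0)// nth_behead.
Qed.

Lemma nth_factors_pyr (j : nat) : (m1 <= j < m1 + m2)%N ->
  nth 0 factors j = xi be`_(j - m1).
Proof.
case: j => [|j jm]; first by lia.
rewrite /= nth_cat size_map size_behead size_tuple ifF; last by lia.
have -> : (j - m1.-1 = j.+1 - m1)%N by lia.
by rewrite (nth_map 0)// size_tuple; lia.
Qed.

Lemma prod_factors : mu1 al = lin_factor al`_0 ->
  \prod_(x <- factors) x = mu al be.
Proof. by move=> mu1E; rewrite big_cons big_cat !big_map /mu mu1E. Qed.

Lemma factors_gt0 (j : nat) : 0 < \prod_(x <- take j factors) x.
Proof.
rewrite big_seq; apply: prodr_gt0 => x /mem_take.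
rewrite inE mem_cat => /predU1P[->|/orP[]/mapP[y _ ->]].
- exact: lin_factor_gt0.
- exact: lt_le_trans ltr01 (xi_ge1 _).
- exact: lt_le_trans ltr01 (xi_ge1 _).
Qed.

Lemma stage_step_first (p : int -> M) (d : R) :
  step_def G al be p -> step_le d p ->
  step_le (lin_factor al`_0 * d) (stage G al be p 1).
Proof.
move=> pdef pd i; rewrite /= m1_gt0.
set t := _ / _.
have al_ge0 := ltW al0_gt0; have al1_ge0 := addr_ge0 ler01 al_ge0.
have t_lin : `|t| <= lin_factor al`_0.
  by rewrite ger0_norm ?divr_ge0// /lin_factor le_max lexx orbT.
have t1_lin : `|1 - t| <= lin_factor al`_0.
  have -> : 1 - t = 1 / (1 + al`_0).
    by rewrite /t; field; rewrite gt_eqF ?addr_gt0.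
  by rewrite ger0_norm ?divr_ge0// /lin_factor le_max lexx.
have q_def k : avg_def G t (p (k %/ 2)%Z) (p ((k + 1) %/ 2)%Z).
  by have := pdef 0%N k; rewrite ltn_addr// m1_gt0; apply.
(* If [k] and [k + 1] have the same parent, the average is at distance 0 from that data point. *)
have avg_refl k : ((k + 1) %/ 2 = k %/ 2)%Z ->
    avg G t (p (k %/ 2)%Z) (p ((k + 1) %/ 2)%Z) = p (k %/ 2)%Z.
  move=> kE; have [_ _] := q_def k.
  by rewrite kE mdistxx mulr0 => /mdist_positivity.
(* By parity, one of two adjacent averages is a data point and the other lies on an edge at that
   point, so only |t| or |1 - t| enters. *)
have [ev|od] : ((i + 1) %/ 2 = i %/ 2)%Z \/
    ((i + 1 + 1) %/ 2 = (i + 1) %/ 2)%Z by lia.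
  have iE : ((i + 1 + 1) %/ 2)%Z = (i %/ 2)%Z + 1 by lia.
  rewrite avg_refl// ev iE; have [_ _] := q_def (i + 1); rewrite ev iE => ->.
  by rewrite ler_pM ?mdist_ge0.
have iE : ((i + 1) %/ 2)%Z = (i %/ 2)%Z + 1 by lia.
rewrite (avg_refl (i + 1))// iE; have [_] := q_def i; rewrite iE => -> _.
by rewrite ler_pM ?mdist_ge0.
Qed.

Lemma stage_step (p : int -> M) (d : R) (j : nat) : step_def G al be p ->
  step_le d p -> (j <= m1 + m2)%N ->
  step_le (\prod_(x <- take j factors) x * d) (stage G al be p j).
Proof.
move=> pdef pd; case: j => [_|j].
  rewrite take0 big_nil mul1r => i /=.
  have [->|->] : ((i + 1) %/ 2)%Z = (i %/ 2)%Z \/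
    ((i + 1) %/ 2)%Z = (i %/ 2)%Z + 1 by lia.
    by rewrite mdistxx; exact: le_trans (mdist_ge0 _ _) (pd i).
  exact: pd.
(* The induction starts at stage 1, because the factor of the first round uses the doubling and not
   only the bound for stage 0. *)
elim: j => [_|j IH jm].
  by rewrite /= take0 big_seq1; exact: stage_step_first.
have {}IH : step_le (\prod_(x <- take j.+1 factors) x * d)
    (stage G al be p j.+1).
  by apply: IH; lia.
have q_def i := pdef j.+1 i (ltac:(lia) : (j.+1 < m1 + m2)%N).
rewrite (take_nth 0) ?size_factors; last by lia.
rewrite -cats1 big_cat big_seq1 [X in X * d]mulrC -mulrA.
set e := (\prod_(_ <- _) _ * d) in IH *; move=> i.
move: q_def; rewrite /step_def [stage _ _ _ _ j.+2]/=; case: ifPn => jm1 q_def.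
  rewrite nth_factors_lin//.
  have al_j : al`_j.+1 \in al by rewrite mem_nth ?size_tuple.
  by have [? ?] := al_neq al_j; rewrite xi_real//; exact: avg_step.
rewrite nth_factors_pyr; last by lia.
have z_im : complex.Im be`_(j.+1 - m1) != 0.
  by apply: be_im; apply: mem_nth; rewrite size_tuple; lia.
have [e1 e2] : i + 2 = i + 1 + 1 /\ i + 1 + 2 = i + 1 + 1 + 1 by lia.
have := q_def (i + 1); have := q_def i; rewrite e1 e2 => q1 q2.
exact: pyramid_step.
Qed.

Lemma refine_step (p : int -> M) (d : R) : mu1 al = lin_factor al`_0 ->
  step_def G al be p -> step_le d p ->
  step_le (mu al be * d) (refine G s al be p).
Proof.
move=> mu1E pdef pd i.
rewrite -prod_factors// -(take_size factors) size_factors.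
rewrite /refine (_ : i + 1 + s - 1 = i + s - 1 + 1); last by lia.
exact: stage_step.
Qed.

(** [C] is chosen before [p] and [d], so one constant serves all refinement levels. Each round adds
    a displacement proportional to the current step bound. *)
Lemma stage_shift (j : nat) : (j <= m1 + m2)%N ->
  exists2 C : R, 0 <= C & forall (p : int -> M) (d : R),
    step_def G al be p -> step_le d p ->
    forall i, mdist (stage G al be p j i) (p (i %/ 2)%Z) <= C * d.
Proof.
elim: j => [_|j IH jm].
  by exists 0 => // p d _ _ i; rewrite /= mdistxx mul0r.
have [|C C_ge0 hC] := IH; first exact: ltnW.
set b := \prod_(x <- take j factors) x.
have b_ge0 : 0 <= b by rewrite ltW// factors_gt0.
suff [c c_ge0 hc] : exists2 c : R, 0 <= c & forall (p : int -> M) (d : R),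
    step_def G al be p -> step_le d p ->
    forall i,
      mdist (stage G al be p j.+1 i) (stage G al be p j i) <= c * (b * d).
  exists (c * b + C) => [|p d pdef pd i]; first by rewrite addr_ge0 ?mulr_ge0.
  apply: le_trans (metric_triangle _ (stage G al be p j i) _) _.
  by rewrite mulrDl -mulrA lerD ?hc ?hC.
have [jm1|jm1] := boolP (j < m1)%N.
  exists `|al`_j / (1 + al`_j)| => // p d pdef pd i.
  have := pdef j i jm; rewrite /= jm1 => q_def.
  exact/avg_shift/(stage_step pdef pd (ltnW jm)).
set z := be`_(j - m1).
have z_im : complex.Im z != 0.
  by apply: be_im; apply: mem_nth; rewrite size_tuple; lia.
exists (`|1 - pyr_r z| * ((1 + modulus z) ^+ 2 / pyr_D z) + `|1 - pyr_t1 z|).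
  have D_ge0 := ltW (pyr_D_gt0 z_im).
  have m1_ge0 := addr_ge0 ler01 (modulus_ge0 z).
  by rewrite addr_ge0 ?mulr_ge0 ?invr_ge0 ?exprn_ge0.
move=> p d pdef pd i; have := pdef j i jm; rewrite /= (negbTE jm1) => q_def.
have qd := stage_step pdef pd (ltnW jm).
have e : i + 2 = i + 1 + 1 by lia.
by apply: pyramid_shift => //; rewrite ?e; exact: qd.
Qed.

Lemma refine_shift : exists2 C : R, 0 <= C & forall (p : int -> M) (d : R),
  step_def G al be p -> step_le d p ->
  forall i, mdist (refine G s al be p i) (p (i %/ 2)%Z) <= C * d.
Proof.
have [C C_ge0 hC] := stage_shift (leqnn _).
(* The index shift by s - 1 moves the parent index by at most |s| + 1. *)
exists (C + (`|s| + 1)%:~R) => [|p d pdef pd i].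
  by rewrite addr_ge0// ler0z; lia.
apply: le_trans (metric_triangle _ (p ((i + s - 1) %/ 2)%Z) _) _.
rewrite mulrDl lerD ?hC//; apply: le_trans (step_le_mdist _ _ pd) _.
have d_ge0 : 0 <= d := le_trans (mdist_ge0 _ _) (pd 0).
by rewrite ler_wpM2r// ler_int; lia.
Qed.

Lemma interpolant_mdist (k : nat) (p : int -> M) (d x : R) :
  admissible G p -> step_le d p ->
  mdist (interpolant G k p x) (p (Num.floor (x * 2 ^+ k))) <= d.
Proof.
move=> padm pd; rewrite /interpolant; set y := x * _; set i := Num.floor y.
have [_ _ g0 _ _] := geodP (padm i).
(* The data point is the geodesic at parameter 0; the fractional part of [y] lies in [0, 1). *)
rewrite -{2}g0.
apply: le_trans (shortest_geodesic_mdist hdist _ _ (geodP (padm i))) _.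
have /andP[y1 y2] : i%:~R <= y < (i + 1)%:~R by rewrite floor_itv.
apply: le_trans (pd i); rewrite ler_piMl ?mdist_ge0//.
rewrite sub0r normrN ger0_norm ?subr_ge0//.
by rewrite intrD in y2; lra.
Qed.

Lemma mu_gt0 : mu1 al = lin_factor al`_0 -> 0 < mu al be.
Proof.
by move=> mu1E; rewrite -prod_factors// -(take_size factors) factors_gt0.
Qed.

Lemma refine_contractivity : mu1 al = lin_factor al`_0 -> mu al be < 1 ->
  has_contractivity_factor G s al be (mu al be).
Proof.
move=> mu1E mu_lt1; split=> [|p _ /delta_step_le[d -> pd] pdef].
  by rewrite mu_gt0.
by rewrite -EFinM; exact/step_le_delta/refine_step.
Qed.

Lemma refine_converges (p : int -> M) : complete_space M ->
  mu1 al = lin_factor al`_0 -> mu al be < 1 -> (delta p < +oo)%E ->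
  refinement_def G s al be p -> converges_from G s al be p.
Proof.
move=> hcompl mu1E mu_lt1 /delta_step_le[d _ pd] pdef.
have mu_ge0 := ltW (mu_gt0 mu1E).
pose q k := iter k (refine G s al be) p.
have qd k : step_le (mu al be ^+ k * d) (q k).
  elim: k => [|k IH]; first by rewrite mul1r.
  by rewrite exprS -mulrA; apply: refine_step => //; exact: (pdef k).2.
have d_ge0 : 0 <= d := le_trans (mdist_ge0 _ _) (pd 0).
have [C C_ge0 hC] := refine_shift.
(* The path goes from the level [k] interpolant to [q k i], to its child [q k.+1 j], to the next
   interpolant; the legs cost 1, [C] and [mu al be] times [mu al be ^+ k * d]. *)
apply: (geometric_steps_cvg_uniform hcompl
  (K := (1 + C + mu al be) * d) (q := mu al be)) => //.
  by rewrite mulr_ge0 ?addr_ge0.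
move=> k x; set i := Num.floor (x * 2 ^+ k); set j := Num.floor (x * 2 ^+ k.+1).
have ji : (j %/ 2)%Z = i by rewrite /j exprSr mulrA floor_half.
apply: le_trans (metric_triangle _ (q k i) _) _.
apply: le_trans (lerD (interpolant_mdist _ _ (pdef k).1 (qd k))
  (metric_triangle _ (q k.+1 j) _)) _.
have h := interpolant_mdist k.+1 x (pdef k.+1).1 (qd k.+1).
rewrite metric_sym in h.
have := hC _ _ (pdef k).2 (qd k) j; rewrite ji metric_sym => h'.
apply: le_trans (lerD (lexx _) (lerD h' h)) _.
by rewrite exprS le_eqVlt; apply/orP; left; apply/eqP; ring.
Qed.

End Scheme.

Theorem corollary4p8
  (R : realType)
  (* the complete connected Riemannian manifold and its geodesic averages *)
  (n : nat) (M : metricType R) (X : riemannian_structure n M)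
  (hdist : is_riemannian_distance X)
  (hconn : connected [set: M])
  (hcompl : complete_space M)
  (G : geodesic_choice X)
  (* the linear scheme, its mask and its symbol *)
  (S : (int -> R) -> int -> R) (a : int -> R)
  (hfin : finite_set [set i | a i != 0])
  (hS : forall f, S f = linear_scheme a f)
  (s : int) (m1 m2 : nat) (hm1 : (1 <= m1)%N) (hm2 : (1 <= m2)%N)
  (al0 : m1.-tuple R) (be : m2.-tuple R[i])
  (hal : forall x, x \in al0 -> x != 0 /\ x != -1)
  (hbe : forall z, z \in be -> complex.Im z != 0)
  (hmax : 0 < \big[Num.max/al0`_0]_(x <- al0) x)
  (hsymb : forall z : R[i], z != 0 -> symbol a z = factored_symbol s al0 be z)
  (* renumbering of the linear factors such that mu1 is attained at the first *)
  (al : m1.-tuple R) (hperm : perm_eq al0 al)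
  (hal1 : 0 < al`_0) (hattain : lin_factor al`_0 = mu1 al0)
  (hmu : mu al be < 1) :
  has_contractivity_factor G s al be (mu al be) /\
  forall p : int -> M, admissible G p -> (delta p < +oo)%E ->
    refinement_def G s al be p -> converges_from G s al be p.
Proof.
(* The minimum is independent of the numbering, so its attainment transfers from [al0] to [al]. *)
have mu1E : mu1 al = lin_factor al`_0 by rewrite hattain -(mu1_perm hperm).
have al_neq x : x \in al -> x != 0 /\ x != -1.
  by rewrite -(perm_mem hperm); exact: hal.
split; first exact: refine_contractivity.
by move=> p _; exact: refine_converges.
Qed.
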